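(* Let $p>2$ be a prime and let $a$ be an integer with $\gcd(a,p)=1$. Then $$\#\,\mathrm{Image}(d_{a,p^2})=\frac{\varphi(p^2)+1+(a/p)}{2}-\#\bigl(d_{a,p^2}(C_1)\cap d_{a,p^2}(C_2)\bigr).$$
   Context: $\varphi$ is Euler's function and $(a/p)$ is the Legendre symbol. $\mathbb Z_n^\ast$ is the group of invertible residues modulo $n$, and $z \bmod n$ denotes the least non-negative residue. The map $d_{a,n}:\mathbb Z_n^\ast\to\mathbb Z$ is $d_{a,n}(x)=(x\bmod n)^2+\bigl((a\cdot x^{-1})\bmod n\bigr)^2$, where $x^{-1}$ is the inverse of $x$ modulo $n$. (Thus $\#\mathrm{Image}(d_{a,n})$ is the number of distinct Euclidean distances $\sqrt{x^2+y^2}$ from the origin to points $(x,y)$ with $xy\equiv a\pmod n$, $1\le x,y\le n-1$.) If $a$ is a quadratic residue modulo $p$, let $b$ be an integer with $0<b<p$ and $b^2\equiv a\pmod p$, and define $C_1=\{b+tp : 0\le t\le p-1\}$ and $C_2=\{p-b+tp : 0\le t\le p-1\}$, with $t$ an integer, as subsets of $\mathbb Z_{p^2}^\ast$. If $a$ is not a quadratic residue modulo $p$, put $C_1=C_2=\emptyset$, so that the last term of the formula is $0$. *)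

(* Defs.v *)
From mathcomp Require Import all_boot all_order all_algebra.
From mathcomp Require Import finmap.

Set Implicit Arguments.
Unset Strict Implicit.
Unset Printing Implicit Defensive.

Import GRing.Theory Num.Theory.
Local Open Scope ring_scope.

Definition quad_residue (a : int) (p : nat) : bool :=
  coprimez a p && [exists x : 'I_p, (x%:Z ^+ 2 == a %[mod p])%Z].

Definition legendre (a : int) (p : nat) : int :=
  if (p %| a)%Z then 0 else if quad_residue a p then 1 else -1.

(* 'Z_n is the ring of integers modulo n only for n > 1; it is used below only
   at n = p ^ 2.  The coercion from 'Z_n to nat is the least non-negative
   residue. *)
Definition dist2 (a : int) (n : nat) (x : {unit 'Z_n}) : int :=
  let u : 'Z_n := val x in
  let v : 'Z_n := a%:~R * u^-1 in
  (u : nat)%:Z ^+ 2 + (v : nat)%:Z ^+ 2.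

Definition im_dist2 (a : int) (n : nat) (A : {set {unit 'Z_n}}) : {fset int} :=
  [fset dist2 a x | x in A]%fset.

(* The units modulo p ^ 2 that are the class of c + t p for some 0 <= t < p. *)
Definition lifts (p : nat) (c : int) : {set {unit 'Z_(p ^ 2)}} :=
  [set x : {unit 'Z_(p ^ 2)} |
    [exists t : 'I_p, val x == (c + t%:Z * p%:Z)%:~R]].

(* The parameter b stands for the chosen square root of a modulo p; it is
   irrelevant when a is not a quadratic residue. *)
Definition C1 (a : int) (p : nat) (b : int) : {set {unit 'Z_(p ^ 2)}} :=
  if quad_residue a p then lifts p b else set0.

Definition C2 (a : int) (p : nat) (b : int) : {set {unit 'Z_(p ^ 2)}} :=
  if quad_residue a p then lifts p (p%:Z - b) else set0.

(* Main.v *)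
Require Import Defs.
From mathcomp Require Import all_boot all_order all_algebra.
From mathcomp Require Import finmap.
From mathcomp Require Import zify ring lra.

(** Write x' for the residue of a / x modulo n = p^2, so that d(x) is the
    integer x^2 + x'^2.  The map x |-> x' is an involution preserving d, and the
    whole count rests on knowing how far d is from separating its orbits.

    Suppose d(x) = d(y).  Since x x' = y y' modulo n, the sums s = x + x' and
    t = y + y' have equal squares modulo n, and so do the differences x - x'
    and y - y'.  If p does not divide x - x', then x - x' = +-(y - y') modulo n.
    If p divides x - x', then x^2 = a modulo p, so p does not divide s, and
    s = +-t modulo n.  A congruence modulo n between these sums or differences
    is an equality: s has the parity of x^2 + x'^2 = d(x), and so have t and
    both differences, so the congruence holds modulo 2n, which the sizes of the
    integers involved forbid unless they are equal.  An equality of sums, or of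
    differences up to sign, together with d(x) = d(y) gives y = x or y = x'.
    The one case left is s = -t modulo n with p dividing both differences; then
    x^2 = a and y = -x modulo p, so that one of x, y lies in C1 and the other
    in C2.  This is [reciprocal_pairs].

    Consequently d separates the orbits of the involution on C2 and on the
    complement of C2, both of which are stable.  On a set A where this holds,
    twice the size of the image is #A plus the number of fixed points in A
    ([orbit_count]).  Adding the two contributions gives
    phi(n) + #{x | x^2 = a}, and #{x | x^2 = a} = 1 + (a/p) by Newton lifting
    of a square root modulo p ([card_partner_fix]).  The values counted twice
    are those in d(~C2) and d(C2), which by the dichotomy above are those in
    d(C1) and d(C2) ([im_dist2_meet]). *)

Set Implicit Arguments.
Unset Strict Implicit.
Unset Printing Implicit Defensive.

Import GRing.Theory Num.Theory.
Local Open Scope ring_scope.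

(** * Congruences between squares *)

Lemma euclidz (p : nat) (m n : int) : prime p ->
  (p %| m * n)%Z = (p %| m)%Z || (p %| n)%Z.
Proof. by move=> p_pr; rewrite !dvdzE abszM Euclid_dvdM. Qed.

Lemma dvdz_primeX_cofactor (p k : nat) (m n : int) : prime p ->
  ~~ (p %| m)%Z -> ((p ^ k)%N %| m * n)%Z -> ((p ^ k)%N %| n)%Z.
Proof.
move=> p_pr pm; rewrite Gauss_dvdzr // coprimezE coprimeXl //.
by rewrite prime_coprime.
Qed.

Lemma odd_prime_ndvd2 (p : nat) : prime p -> (2 < p)%N -> ~~ (p %| 2)%Z.
Proof. by move=> p_pr p2; rewrite dvdzE gtnNdvd. Qed.

(** As [p] is odd and prime to [u], it cannot divide both [u - v] and [u + v],
    so the whole power goes into one of them. *)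
Lemma eq_sqr_mod_primeX (p k : nat) (u v : int) : prime p -> (2 < p)%N ->
  ~~ (p %| u)%Z -> ((p ^ k)%N %| u ^+ 2 - v ^+ 2)%Z ->
  ((p ^ k)%N %| u - v)%Z \/ ((p ^ k)%N %| u + v)%Z.
Proof.
move=> p_pr p2 pu; rewrite subr_sqr => dvd_uv.
have [puv|puv] := boolP (p %| u - v)%Z; last first.
  by right; apply: dvdz_primeX_cofactor puv dvd_uv.
left; rewrite mulrC in dvd_uv; apply: dvdz_primeX_cofactor dvd_uv => //.
apply: contra pu => puv'.
have : (p %| 2 * u)%Z.
  have -> : 2 * u = u - v + (u + v) by ring.
  exact: rpredD.
by rewrite euclidz // (negbTE (odd_prime_ndvd2 p_pr p2)).
Qed.

(** Parity doubles the modulus: this is what turns congruences modulo [p ^ 2]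
    between sums, or differences, of two residues into equalities. *)
Lemma eq_same_parity_mod_odd (n : nat) (u v : int) : odd n ->
  (n %| u - v)%Z -> (2 %| u - v)%Z -> `|u - v| < 2 * n%:Z -> u = v.
Proof.
move=> n_odd n_uv two_uv lt_uv.
have : ((2 * n)%N %| u - v)%Z.
  by rewrite PoszM Gauss_dvdz ?n_uv ?two_uv // coprimezE /= coprime2n.
rewrite dvdzE => /dvdn_leq; lia.
Qed.

Lemma dvd2_sqrB (x : int) : (2 %| x ^+ 2 - x)%Z.
Proof.
have [q ->] : exists q, x ^+ 2 - x = q * 2; last exact: dvdz_mull.
have [r [-> | ->]] : exists r, x = r * 2 \/ x = r * 2 + 1 by exists (x %/ 2)%Z; lia.
  by exists (2 * r ^+ 2 - r); ring.
by exists (2 * r ^+ 2 + r); ring.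
Qed.

Lemma sum_sqr_parity (x x' y y' : int) :
  x ^+ 2 + x' ^+ 2 = y ^+ 2 + y' ^+ 2 -> (2 %| x + x' - (y + y'))%Z.
Proof.
move: (dvd2_sqrB x) (dvd2_sqrB x') (dvd2_sqrB y) (dvd2_sqrB y'); lia.
Qed.

Lemma pair_eq_of_sum (x x' y y' : int) :
  x ^+ 2 + x' ^+ 2 = y ^+ 2 + y' ^+ 2 -> x + x' = y + y' -> x = y \/ x = y'.
Proof.
move=> eq_d eq_s; have : (x - y) * (x - y') == 0.
  have def_x' : x' = y + y' - x by lia.
  apply/eqP; move: eq_d; rewrite def_x'; lia.
by rewrite mulf_eq0 !subr_eq0 => /orP[]/eqP; auto.
Qed.

Lemma pair_eq_of_diff (x x' y y' : int) :
  0 < x -> 0 < x' -> 0 < y -> 0 < y' ->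
  x ^+ 2 + x' ^+ 2 = y ^+ 2 + y' ^+ 2 -> x - x' = y - y' -> x = y.
Proof.
move=> x0 x'0 y0 y'0 eq_d eq_diff.
have : (x - y) * (x + y') == 0.
  have def_x' : x' = x - y + y' by lia.
  apply/eqP; move: eq_d; rewrite def_x'; lia.
by rewrite mulf_eq0 subr_eq0 => /orP[]/eqP; lia.
Qed.

(** Only square roots of [a] modulo [p] lying in opposite classes can give the
    same sum of squares for two different pairs. *)
Lemma reciprocal_pairs (p : nat) (a x x' y y' : int) :
  prime p -> (2 < p)%N ->
  [/\ 0 < x < (p ^ 2)%N%:Z, 0 < x' < (p ^ 2)%N%:Z,
      0 < y < (p ^ 2)%N%:Z & 0 < y' < (p ^ 2)%N%:Z] ->
  ((p ^ 2)%N %| x * x' - a)%Z -> ((p ^ 2)%N %| y * y' - a)%Z ->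
  ~~ (p %| a)%Z ->
  x ^+ 2 + x' ^+ 2 = y ^+ 2 + y' ^+ 2 ->
  [\/ x = y, x = y' | (p %| x ^+ 2 - a)%Z /\ (p %| x + y)%Z].
Proof.
move=> p_pr p2 [xb x'b yb y'b] xx' yy' pa eq_d.
have p_n : (p %| (p ^ 2)%N%:Z)%Z by rewrite dvdzE dvdn_exp.
have n_odd : odd (p ^ 2) by rewrite oddX; case: (even_prime p_pr) p2 => [->|->].
have pxx' := dvdz_trans p_n xx'.
have parity := sum_sqr_parity eq_d.
set n := (p ^ 2)%N in xb x'b yb y'b xx' yy' n_odd p_n.
have dvd_s : (n %| (x + x') ^+ 2 - (y + y') ^+ 2)%Z.
  have -> : (x + x') ^+ 2 - (y + y') ^+ 2 =
      2 * (x * x' - a) - 2 * (y * y' - a) +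
      (x ^+ 2 + x' ^+ 2 - (y ^+ 2 + y' ^+ 2)) by ring.
  by rewrite eq_d subrr addr0 rpredB // dvdz_mull.
have dvd_d : (n %| (x - x') ^+ 2 - (y - y') ^+ 2)%Z.
  have -> : (x - x') ^+ 2 - (y - y') ^+ 2 =
      2 * (y * y' - a) - 2 * (x * x' - a) +
      (x ^+ 2 + x' ^+ 2 - (y ^+ 2 + y' ^+ 2)) by ring.
  by rewrite eq_d subrr addr0 rpredB // dvdz_mull.
(* [p] cannot divide both [x + x'] and [x - x'], so that at least one of [dvd_s]
   and [dvd_d] can be factored. *)
have [p_d|np_d] := boolP (p %| x - x')%Z; last first.
  have [n_d|n_d] := eq_sqr_mod_primeX p_pr p2 np_d dvd_d.
    have eq_diff : x - x' = y - y'.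
      by apply: (eq_same_parity_mod_odd n_odd n_d); (clear -xb x'b yb y'b parity; lia).
    by apply: Or31; apply: pair_eq_of_diff eq_d eq_diff; (clear -xb x'b yb y'b; lia).
  have eq_diff : x - x' = y' - y.
    apply: (eq_same_parity_mod_odd n_odd); first by rewrite -(opprB y) opprK.
      by clear -xb x'b yb y'b parity; lia.
    by clear -xb x'b yb y'b; lia.
  by apply: Or32; rewrite (addrC (y ^+ 2)) in eq_d;
    apply: pair_eq_of_diff eq_d eq_diff; (clear -xb x'b yb y'b; lia).
have px2 : (p %| x ^+ 2 - a)%Z.
  have -> : x ^+ 2 - a = x * (x - x') + (x * x' - a) by ring.
  by rewrite rpredD // dvdz_mull.
have np_x : ~~ (p %| x)%Z.
  apply: contra pa => px; have -> : a = x * x - (x ^+ 2 - a) by ring.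
  by rewrite rpredB // dvdz_mull.
have np_s : ~~ (p %| x + x')%Z.
  apply: contra np_x => px; have : (p %| 2 * x)%Z.
    have -> : 2 * x = (x + x') + (x - x') by ring.
    exact: rpredD.
  by rewrite euclidz // (negbTE (odd_prime_ndvd2 p_pr p2)).
have [n_s|n_s] := eq_sqr_mod_primeX p_pr p2 np_s dvd_s.
  have eq_s : x + x' = y + y'.
    by apply: (eq_same_parity_mod_odd n_odd n_s); (clear -xb x'b yb y'b parity; lia).
  by case: (pair_eq_of_sum eq_d eq_s); [apply: Or31|apply: Or32].
(* Here [x + x'] is opposite to [y + y'] modulo [p ^ 2], while [p] divides both
   differences, hence [2 * (x + y)]. *)
apply: Or33; split=> //.
have p_e : (p %| y - y')%Z.
  have : (p %| (y - y') * (y - y'))%Z.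
    have -> : (y - y') * (y - y') = (x - x') * (x - x') -
        ((x - x') ^+ 2 - (y - y') ^+ 2) by ring.
    exact: rpredB (dvdz_mull _ p_d) (dvdz_trans p_n dvd_d).
  by rewrite euclidz // orbb.
have : (p %| 2 * (x + y))%Z.
  have -> : 2 * (x + y) = (x + x' + (y + y')) + ((x - x') + (y - y')) by ring.
  exact: rpredD (dvdz_trans p_n n_s) (rpredD p_d p_e).
by rewrite euclidz // (negbTE (odd_prime_ndvd2 p_pr p2)).
Qed.

(** * Counting images under a map that separates the orbits of an involution *)

(** The fibres of [f] on [A] are the orbits of [s]; an orbit of size two is
    counted twice by [#|A|], and a fixed point once by [#|A|] and once more by
    the last term. *)
Lemma orbit_count (T : finType) (K : choiceType) (f : T -> K) (s : T -> T)
    (A : {set T}) :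
  involutive s -> {in A, forall x, s x \in A} ->
  {in A &, forall x y, f x = f y <-> y = x \/ y = s x} ->
  (2 * #|` [fset f x | x in A]%fset| = #|A| + #|[set x in A | s x == x]|)%N.
Proof.
move=> sK; have [n] := ubnP #|A|; elim: n A => // n IHn A ltAn sA fA.
have [->|[x xA]] := set_0Vmem A.
  rewrite cards0 (_ : [fset f x | x in set0]%fset = fset0) ?cardfs0.
    rewrite (_ : [set x in set0 | _] = set0) ?cards0 //.
    by apply/setP=> x; rewrite !inE.
  by apply/fsetP=> y; rewrite inE; apply/imfsetP=> -[x /=]; rewrite inE.
(* Induction on [#|A|], removing the orbit of [x]. *)
pose B := A :\: [set x; s x].
have BA y : (y \in B) = [&& y != x, y != s x & y \in A].
  by rewrite !inE negb_or andbA.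
have imA : [fset f y | y in A]%fset = (f x |` [fset f y | y in B])%fset.
  apply/fsetP=> v; rewrite inE inE; apply/imfsetP/orP => /= [[y yA ->]|].
    have [/eqP|nyx] := boolP (f y == f x); first by left; apply/eqP.
    right; apply/imfsetP; exists y => //=; rewrite BA yA andbT.
    by apply/andP; split; apply: contra nyx => /eqP y_x; apply/eqP/esym/fA => //; auto.
  case=> [/eqP->|/imfsetP[y /=]]; first by exists x.
  by rewrite BA => /and3P[_ _ yA] ->; exists y.
have fxB : f x \notin [fset f y | y in B]%fset.
  apply/imfsetP=> -[y /=]; rewrite BA => /and3P[nyx nysx yA] /(fA x y xA yA).
  by case=> /eqP; apply/negP.
have sxA := sA _ xA.
have sub : [set x; s x] \subset A by apply/subsetP=> y; rewrite !inE => /orP[]/eqP->.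
have cardA : #|A| = (#|[set x; s x]| + #|B|)%N.
  by rewrite -(cardsID [set x; s x] A) (setIidPr sub).
have cardF : #|[set y in A | s y == y]| =
    (#|[set y in [set x; s x] | s y == y]| + #|[set y in B | s y == y]|)%N.
  rewrite -(cardsID [set x; s x] [set y in A | s y == y]).
  congr (_ + _)%N; apply: eq_card => y.
    rewrite !inE; have := subsetP sub y; rewrite !inE.
    by case: (_ || _); rewrite ?andbF //= => ->; rewrite ?andbT.
  by rewrite !inE andbA.
have orb : (#|[set x; s x]| + #|[set y in [set x; s x] | s y == y]|)%N = 2.
  have [e|ne] := eqVneq (s x) x.
    rewrite e setUid cards1 (_ : [set y in _ | _] = [set x]) ?cards1 //.
    by apply/setP=> y; rewrite !inE; case: eqP => // ->; rewrite e eqxx.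
  rewrite cards2 eq_sym ne (_ : [set y in _ | _] = set0) ?cards0 //.
  apply/setP=> y; rewrite !inE; apply/negP=> /andP[/orP[]/eqP-> ].
    by rewrite (negbTE ne).
  by rewrite sK eq_sym (negbTE ne).
have IH : (2 * #|` [fset f y | y in B]%fset| = #|B| + #|[set y in B | s y == y]|)%N.
  apply: IHn.
  - by rewrite cardA in ltAn; move: ltAn; rewrite cards2; lia.
  - move=> y; rewrite !BA => /and3P[nyx nysx yA]; rewrite sA // andbT.
    by apply/andP; split; [apply: contra nysx | apply: contra nyx] => /eqP e;
      rewrite -[y]sK e // sK.
  - by move=> y z; rewrite !BA => /and3P[_ _ yA] /and3P[_ _ zA]; apply: fA.
rewrite imA cardfsU1 fxB mulnDr IH cardA cardF; lia.
Qed.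

Lemma card_fset_im_setC (T : finType) (K : choiceType) (f : T -> K)
    (A : {set T}) :
  (#|` [fset f x | x in [set: T]]%fset| +
   #|` ([fset f x | x in ~: A] `&` [fset f x | x in A])%fset| =
   #|` [fset f x | x in ~: A]%fset| + #|` [fset f x | x in A]%fset|)%N.
Proof.
rewrite -[RHS]cardfsUI; congr (_ + _)%N; apply: (congr1 (fun F : {fset K} => #|` F|)).
apply/fsetP=> v; rewrite in_fsetU.
apply/imfsetP/orP => /= [[x _ ->] | [] /imfsetP[x _ ->]]; try by exists x.
by have [xA|xA] := boolP (x \in A); [right | left];
  apply/imfsetP; exists x; rewrite //= inE.
Qed.

(** * Units modulo the square of a prime *)

Lemma intr_val_Zp (n : nat) (u : 'Z_n) : (1 < n)%N -> (u : nat)%:Z%:~R = u.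
Proof. by move=> n1; rewrite -pmulrn natr_Zp. Qed.

Lemma intr_Zp_eq0 (n : nat) (m : int) : (1 < n)%N ->
  (m%:~R == 0 :> 'Z_n) = (n %| m)%Z.
Proof.
move=> n1; rewrite dvdzE; case: m => m; rewrite ?NegzE ?mulrNz ?oppr_eq0 ?abszN /=;
 rewrite -(inj_eq val_inj) /= val_Zp_nat //.
Qed.

Lemma quad_residueP (p : nat) (a : int) : prime p -> ~~ (p %| a)%Z ->
  reflect (exists c : int, p %| c ^+ 2 - a)%Z (quad_residue a p).
Proof.
move=> p_pr np_a; have p_gt0 := prime_gt0 p_pr.
rewrite /quad_residue coprimez_sym coprimezE prime_coprime // -dvdzE np_a /=.
apply: (iffP existsP) => [[c]|[c c2a]].
  by rewrite eqz_mod_dvd; exists c%:Z.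
have lt_c : (`|(c %% p)%Z| < p)%N by lia.
exists (Ordinal lt_c); rewrite /= (_ : `|(c %% p)%Z|%N%:Z = (c %% p)%Z); last by lia.
rewrite eqz_mod_dvd.
have -> : (c %% p)%Z ^+ 2 - a = c ^+ 2 - a - (c %/ p)%Z * (c + (c %% p)%Z) * p.
  by move: (c %/ p)%Z (c %% p)%Z (divz_eq c p) => q r ->; ring.
by rewrite rpredB // dvdz_mull.
Qed.

Section PrimeSquare.

Variable p : nat.
Hypotheses (p_pr : prime p) (p_gt2 : (2 < p)%N).

Notation n := (p ^ 2)%N.
Notation rep u := (nat_of_ord (val u))%:Z.

Let n_gt1 : (1 < n)%N.
Proof. by rewrite -(exp1n 2) ltn_exp2r // prime_gt1. Qed.

Let p_n : (p %| n%:Z)%Z.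
Proof. by rewrite dvdzE dvdn_exp. Qed.

Lemma intr_unit (m : int) : ((m%:~R : 'Z_n) \is a GRing.unit) = ~~ (p %| m)%Z.
Proof.
rewrite dvdzE -prime_coprime // -(@coprime_pexpl 2) //.
case: m => m; rewrite ?NegzE ?mulrNz ?unitrN ?abszN /= -pmulrn unitZpE //.
Qed.

Lemma ndvd_rep (u : {unit 'Z_n}) : ~~ (p %| rep u)%Z.
Proof. by rewrite -intr_unit intr_val_Zp // (valP u). Qed.

Lemma rep_bounds (u : {unit 'Z_n}) : 0 < rep u < n%:Z.
Proof.
have := ltn_ord (val u); rewrite [X in (_ < X)%N]Zp_cast // => lt_u.
have := ndvd_rep u; case: (nat_of_ord _) lt_u => [|m] lt_m; first by rewrite dvdz0.
by move=> _; rewrite ltz_nat lt_m.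
Qed.

Lemma eq_rep (u v : {unit 'Z_n}) : rep u = rep v -> u = v.
Proof. by case=> /val_inj/val_inj. Qed.

Lemma intr_Zp_eq (k l : int) : (k%:~R == l%:~R :> 'Z_n) = (n %| k - l)%Z.
Proof. by rewrite -subr_eq0 -intrB intr_Zp_eq0. Qed.

(** As [t] runs over all residues modulo [p], [c + t * p] runs modulo [p ^ 2] over
    the whole class of [c] modulo [p]. *)
Lemma mem_lifts (c : int) (x : {unit 'Z_n}) : (x \in lifts p c) = (p %| rep x - c)%Z.
Proof.
rewrite inE; apply/existsP/idP => [[t] | /dvdzP[k def_k]].
  rewrite -[X in X == _](intr_val_Zp _ n_gt1) intr_Zp_eq => /(dvdz_trans p_n).
  by rewrite opprD addrA rpredBr // dvdz_mull.
have p_gt0 := prime_gt0 p_pr.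
have lt_k : (`|(k %% p)%Z| < p)%N by lia.
exists (Ordinal lt_k); rewrite -[X in X == _](intr_val_Zp _ n_gt1) intr_Zp_eq /=.
have -> : `|(k %% p)%Z|%N%:Z = (k %% p)%Z by lia.
have -> : rep x - (c + (k %% p)%Z * p) = (k %/ p)%Z * n%:Z.
  rewrite opprD addrA def_k -mulrBl expnS expn1 PoszM mulrA.
  by congr (_ * _); rewrite {1}(divz_eq k p); ring.
exact: dvdz_mull.
Qed.

Variable a : int.
Hypothesis np_a : ~~ (p %| a)%Z.

(** The involution [x |-> a / x]; the default value [x] of [insubd] never occurs,
    because the quotient is a unit ([val_partner]). *)
Definition partner (x : {unit 'Z_n}) : {unit 'Z_n} :=
  insubd x (a%:~R * (val x)^-1).

Lemma val_partner (x : {unit 'Z_n}) : val (partner x) = a%:~R * (val x)^-1.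
Proof.
rewrite insubdK // -topredE /= unitrM unitrV (valP x) andbT.
by rewrite intr_unit.
Qed.

Lemma partnerK : involutive partner.
Proof.
move=> x; apply: val_inj; rewrite !val_partner invrM ?unitrV ?(valP x) ?intr_unit //.
by rewrite invrK mulrCA divrr ?intr_unit ?mulr1.
Qed.

Lemma rep_partner (x : {unit 'Z_n}) : (n %| rep x * rep (partner x) - a)%Z.
Proof.
rewrite -intr_Zp_eq intrM !intr_val_Zp // val_partner mulrCA divrr ?mulr1 //.
exact: valP.
Qed.

Lemma dist2E (x : {unit 'Z_n}) : dist2 a x = rep x ^+ 2 + rep (partner x) ^+ 2.
Proof. by rewrite /dist2 val_partner. Qed.

Lemma dist2_partner (x : {unit 'Z_n}) : dist2 a (partner x) = dist2 a x.
Proof. by rewrite !dist2E partnerK addrC. Qed.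

Lemma dist2_eq (x y : {unit 'Z_n}) : dist2 a x = dist2 a y ->
  [\/ y = x, y = partner x | (p %| rep x ^+ 2 - a)%Z /\ (p %| rep x + rep y)%Z].
Proof.
rewrite !dist2E => eq_d.
have bounds : [/\ 0 < rep x < n%:Z, 0 < rep (partner x) < n%:Z,
    0 < rep y < n%:Z & 0 < rep (partner y) < n%:Z] by split; apply: rep_bounds.
have [||] := reciprocal_pairs p_pr p_gt2 bounds
  (rep_partner x) (rep_partner y) np_a eq_d.
- by move/eq_rep->; apply: Or31.
- by move/eq_rep=> ->; rewrite partnerK; apply: Or32.
by move=> ?; apply: Or33.
Qed.

Lemma lifts_partner (c : int) (x : {unit 'Z_n}) : (p %| c ^+ 2 - a)%Z ->
  x \in lifts p c -> partner x \in lifts p c.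
Proof.
rewrite !mem_lifts => c2a x_c.
have : (p %| rep x * (rep (partner x) - c))%Z.
  have -> : rep x * (rep (partner x) - c) =
      (rep x * rep (partner x) - a) - (c ^+ 2 - a) - (rep x - c) * c by ring.
  exact: rpredB (rpredB (dvdz_trans p_n (rep_partner x)) c2a) (dvdz_mulr _ x_c).
by rewrite euclidz // (negbTE (ndvd_rep x)).
Qed.

Lemma partner_fix (x : {unit 'Z_n}) : (partner x == x) = (val x ^+ 2 == a%:~R).
Proof.
rewrite -val_eqE val_partner expr2.
apply/eqP/eqP => e; first by rewrite -{1}e divrK ?(valP x).
by rewrite -e mulrK ?(valP x).
Qed.

Lemma sqrt_mod_dvd (x : {unit 'Z_n}) : val x ^+ 2 = a%:~R -> (p %| rep x ^+ 2 - a)%Z.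
Proof.
move=> x2; apply: dvdz_trans p_n _.
by rewrite -intr_Zp_eq rmorphXn /= intr_val_Zp // x2.
Qed.

(** One Newton step [c - (c ^+ 2 - a) / (2 * c)] starting from a root modulo [p]:
    its error is the square of [(c ^+ 2 - a) / (2 * c)], which vanishes modulo
    [p ^ 2]. *)
Lemma sqrt_mod_lift (c : int) : (p %| c ^+ 2 - a)%Z ->
  exists x : {unit 'Z_n}, val x ^+ 2 = a%:~R.
Proof.
move=> c2a; have np_c : ~~ (p %| c)%Z.
  apply: contra np_a => pc.
  have -> : a = c * c - (c ^+ 2 - a) by ring.
  by rewrite rpredB ?dvdz_mull.
pose e : 'Z_n := (c ^+ 2 - a)%:~R; pose i2c : 'Z_n := ((2 * c)%:~R)^-1.
have u2c : ((2 * c)%:~R : 'Z_n) \is a GRing.unit.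
  by rewrite intr_unit euclidz // negb_or odd_prime_ndvd2.
have e2 : e ^+ 2 = 0.
  apply/eqP; rewrite /e -rmorphXn /= intr_Zp_eq0 // expnS expn1 PoszM expr2.
  exact: dvdz_mul.
pose y : 'Z_n := c%:~R - e * i2c.
have y2 : y ^+ 2 = a%:~R.
  rewrite /y sqrrB exprMn e2 mul0r addr0.
  have -> : (c%:~R * (e * i2c)) *+ 2 = e.
    rewrite -mulr_natl [LHS](_ : _ = e * ((2 * c)%:~R * i2c)); last first.
      by rewrite intrM; ring.
    by rewrite divrr ?mulr1.
  by rewrite /e intrB rmorphXn /= opprB addrC subrK.
have uy : y \is a GRing.unit.
  by rewrite -(@unitrX_pos _ _ 2) // y2 intr_unit.
by exists (Sub y uy); rewrite SubK.
Qed.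

Lemma sqrt_mod_unique (x y : {unit 'Z_n}) : val x ^+ 2 = a%:~R -> val y ^+ 2 = a%:~R ->
  val y = val x \/ val y = - val x.
Proof.
move=> x2 y2.
have [|||] := @eq_sqr_mod_primeX p 2 (rep y) (rep x) p_pr p_gt2.
- exact: ndvd_rep.
- by rewrite -intr_Zp_eq !rmorphXn /= !intr_val_Zp // x2 y2.
- by rewrite -intr_Zp_eq !intr_val_Zp // => /eqP; left.
by rewrite -[rep x]opprK -intr_Zp_eq rmorphN /= !intr_val_Zp // => /eqP; right.
Qed.

Lemma card_partner_fix :
  #|[set x : {unit 'Z_n} | partner x == x]| = if quad_residue a p then 2%N else 0%N.
Proof.
case: (quad_residueP p_pr np_a) => [[c c2a] | no_c].
  have [x x2] := sqrt_mod_lift c2a.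
  have uNx : - val x \is a GRing.unit by rewrite unitrN (valP x).
  pose y : {unit 'Z_n} := Sub (- val x) uNx.
  have nxy : x != y.
    apply/eqP=> /(congr1 val); rewrite SubK => xNx.
    have : (n %| rep x - - rep x)%Z.
      by rewrite -intr_Zp_eq rmorphN /= intr_val_Zp // -xNx.
    move/(dvdz_trans p_n); rewrite (_ : rep x - - rep x = 2 * rep x); last by ring.
    by rewrite euclidz // (negbTE (ndvd_rep x)) (negbTE (odd_prime_ndvd2 p_pr p_gt2)).
  rewrite (_ : [set _ | _] = [set x; y]) ?cards2 ?nxy //.
  apply/setP=> z; rewrite !inE partner_fix.
  apply/eqP/orP => [z2 | [/eqP-> | /eqP->]] //; last by rewrite SubK sqrrN.
  by have [e|e] := sqrt_mod_unique x2 z2; [left|right];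
    apply/eqP/val_inj; rewrite ?SubK.
apply/eqP; rewrite cards_eq0; apply/eqP/setP=> x; rewrite !inE partner_fix.
by apply/eqP=> /sqrt_mod_dvd x2a; apply: no_c; exists (rep x).
Qed.

Lemma card_im_dist2 (A : {set {unit 'Z_n}}) :
  {in A, forall x, partner x \in A} ->
  {in A &, forall x y, ~ ((p %| rep x ^+ 2 - a)%Z /\ (p %| rep x + rep y)%Z)} ->
  (2 * #|` im_dist2 a A| = #|A| + #|[set x in A | partner x == x]|)%N.
Proof.
move=> partnerA no_exc; apply: orbit_count => //; first exact: partnerK.
move=> x y xA yA; split=> [/dist2_eq[->|->|/no_exc[]]|[]->] //; auto.
by rewrite dist2_partner.
Qed.

(** ** The residue classes of the square roots of [a] *)

Variable b : int.
Hypothesis b2a : quad_residue a p -> (p %| b ^+ 2 - a)%Z.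

Let np_2b : quad_residue a p -> ~~ (p %| 2 * b)%Z.
Proof.
move=> qr; rewrite euclidz // negb_or odd_prime_ndvd2 //.
apply: contra np_a => pb; have -> : a = b * b - (b ^+ 2 - a) by ring.
by rewrite rpredB ?b2a // dvdz_mull.
Qed.

Lemma mem_C1 (x : {unit 'Z_n}) :
  (x \in C1 a p b) = quad_residue a p && (p %| rep x - b)%Z.
Proof. by rewrite /C1; case: ifP => _; [rewrite mem_lifts | rewrite inE]. Qed.

Lemma mem_C2 (x : {unit 'Z_n}) :
  (x \in C2 a p b) = quad_residue a p && (p %| rep x + b)%Z.
Proof.
rewrite /C2; case: ifP => _ /=; last by rewrite inE.
by rewrite mem_lifts // opprB addrA (rpredBr _ (dvdzz p)).
Qed.

Lemma C1_notin_C2 (x : {unit 'Z_n}) : x \in C1 a p b -> x \notin C2 a p b.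
Proof.
rewrite mem_C1 mem_C2 => /andP[qr xb]; rewrite qr /=.
apply: contra (np_2b qr) => xNb.
have -> : 2 * b = (rep x + b) - (rep x - b) by ring.
exact: rpredB.
Qed.

Lemma C2_partner : {in C2 a p b, forall x, partner x \in C2 a p b}.
Proof.
rewrite /C2; case: ifP => [qr x | _ x]; last by rewrite inE.
apply: lifts_partner => //.
have -> : (p%:Z - b) ^+ 2 - a = (b ^+ 2 - a) + (p%:Z - 2 * b) * p by ring.
by rewrite rpredD ?b2a // dvdz_mull.
Qed.

Lemma setC_C2_partner : {in ~: C2 a p b, forall x, partner x \in ~: C2 a p b}.
Proof. by move=> x; rewrite !inE; apply: contra => /C2_partner; rewrite partnerK. Qed.

(** The pairs left over by [dist2_eq] are, modulo [p], [(b, - b)] and [(- b, b)]. *)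
Lemma opposite_roots_C1_C2 (x y : {unit 'Z_n}) :
  (p %| rep x ^+ 2 - a)%Z /\ (p %| rep x + rep y)%Z ->
  (x \in C1 a p b) && (y \in C2 a p b) || (x \in C2 a p b) && (y \in C1 a p b).
Proof.
rewrite !mem_C1 !mem_C2; move: (rep x) (rep y) => X Y [X2a XY].
have qr : quad_residue a p by apply/(quad_residueP p_pr np_a); exists X.
rewrite qr /=; have : (p %| (X - b) * (X + b))%Z.
  have -> : (X - b) * (X + b) = (X ^+ 2 - a) - (b ^+ 2 - a) by ring.
  by rewrite rpredB // b2a.
rewrite euclidz // => /orP[Xb|Xb]; rewrite Xb /=; apply/orP; [left|right].
  have -> : Y + b = (X + Y) - (X - b) by ring.
  exact: rpredB.
have -> : Y - b = (X + Y) - (X + b) by ring.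
exact: rpredB.
Qed.

Lemma card_im_dist2_C2 :
  (2 * #|` im_dist2 a (C2 a p b)| =
   #|C2 a p b| + #|[set x in C2 a p b | partner x == x]|)%N.
Proof.
apply: card_im_dist2; first exact: C2_partner.
move=> x y xC2 yC2 /opposite_roots_C1_C2/orP[]/andP[].
  by move/C1_notin_C2/negP.
by move=> _ /C1_notin_C2/negP.
Qed.

Lemma card_im_dist2_setC_C2 :
  (2 * #|` im_dist2 a (~: C2 a p b)| =
   #|~: C2 a p b| + #|[set x in ~: C2 a p b | partner x == x]|)%N.
Proof.
apply: card_im_dist2; first exact: setC_C2_partner.
move=> x y; rewrite !inE => /negP xC2 /negP yC2.
by case/opposite_roots_C1_C2/orP=> /andP[].
Qed.

(** A value taken both outside and inside [C2] cannot come from one orbit of the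
    involution, as [C2] is stable, so it comes from a pair in opposite classes. *)
Lemma im_dist2_meet :
  (im_dist2 a (~: C2 a p b) `&` im_dist2 a (C2 a p b) =
   im_dist2 a (C1 a p b) `&` im_dist2 a (C2 a p b))%fset.
Proof.
apply/fsetP=> v; rewrite !in_fsetI.
apply/andP/andP=> -[/imfsetP[x /= xA def_v] v2]; split=> //; last first.
  by apply/imfsetP; exists x; rewrite //= inE C1_notin_C2.
have /imfsetP[y /= yC2 def_v'] := v2.
have eq_d : dist2 a x = dist2 a y by rewrite -def_v -def_v'.
rewrite inE in xA.
have [y_x|y_x|/opposite_roots_C1_C2/orP[]/andP[]] := dist2_eq eq_d.
- by rewrite y_x (negbTE xA) in yC2.
- by rewrite -(partnerK x) -y_x C2_partner in xA.
- by move=> xC1 _; apply/imfsetP; exists x.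
- by rewrite (negbTE xA).
Qed.

End PrimeSquare.

(** * The count *)

Theorem theorem13 (p : nat) (a b : int)
    (p_prime : prime p) (p_gt2 : (2 < p)%N) (a_coprime : gcdz a p = 1)
    (b_sqrt : quad_residue a p ->
       [/\ 0 < b, b < p%:Z & (b ^+ 2 = a %[mod p])%Z]) :
  (#|` im_dist2 a [set: {unit 'Z_(p ^ 2)}] |)%:R =
    ((totient (p ^ 2))%:R + 1 + (legendre a p)%:~R) / 2
    - (#|` (im_dist2 a (C1 a p b) `&` im_dist2 a (C2 a p b))%fset |)%:R :> rat.
Proof.
have np_a : ~~ (p %| a)%Z.
  by rewrite dvdzE -prime_coprime // coprime_sym -coprimezE /coprimez a_coprime.
have b2a : quad_residue a p -> (p %| b ^+ 2 - a)%Z.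
  by case/b_sqrt=> _ _ /eqP; rewrite eqz_mod_dvd.
have := card_fset_im_setC (@dist2 a (p ^ 2)) (C2 a p b).
rewrite -!/(im_dist2 _ _) (im_dist2_meet p_prime p_gt2 np_a b2a) => split_im.
pose fixed (A : {set {unit 'Z_(p ^ 2)}}) :=
  [set x : {unit 'Z_(p ^ 2)} in A | partner a x == x].
have fix_split : (#|fixed (C2 a p b)| + #|fixed (~: C2 a p b)| =
    #|[set x : {unit 'Z_(p ^ 2)} | partner a x == x]|)%N.
  rewrite -[RHS](cardsID (C2 a p b)).
  by congr (_ + _)%N; apply: eq_card => x; rewrite !inE // andbC.
have card_units : (#|C2 a p b| + #|~: C2 a p b| = totient (p ^ 2))%N.
  by rewrite cardsC -cardsT -card_units_Zp // expn_gt0 prime_gt0.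
have leg : (legendre a p)%:~R + 1 =
    #|[set x : {unit 'Z_(p ^ 2)} | partner a x == x]|%:R :> rat.
  rewrite (card_partner_fix p_prime p_gt2 np_a) /legendre (negbTE np_a).
  by case: quad_residue.
have count : (2 * (#|` im_dist2 a [set: {unit 'Z_(p ^ 2)}]| +
     #|` (im_dist2 a (C1 a p b) `&` im_dist2 a (C2 a p b))%fset|) =
     totient (p ^ 2) + #|[set x : {unit 'Z_(p ^ 2)} | partner a x == x]|)%N.
  rewrite split_im mulnDr (card_im_dist2_setC_C2 p_prime p_gt2 np_a b2a).
  rewrite (card_im_dist2_C2 p_prime p_gt2 np_a b2a) -fix_split -card_units.
  by rewrite [RHS]addnACA addnC.
move/(congr1 (fun k : nat => k%:R : rat)): count.
rewrite natrM !natrD -leg; lra.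
Qed.
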